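(* It is undecidable, given a language $L$ accepted by a deterministic real-time Turing machine with a one-way read-only input and two $1$-reversal-bounded worktapes, whether $L$ is dense. That is, there is no algorithm which, given any such machine $M$ with input alphabet $\Sigma$, decides whether $\inf(L(M)) = \Sigma^*$.
   Context: For an alphabet $\Sigma$ and $L \subseteq \Sigma^*$, let $\inf(L) = \{y \in \Sigma^* \mid xyz \in L \text{ for some } x,z \in \Sigma^*\}$. $L$ is dense if $\inf(L) = \Sigma^*$. A deterministic Turing machine with a one-way read-only input and two worktapes has a finite set of states, a read-only input scanned from left to right, and two separate bi-infinite read/write worktapes, both initially blank, each with its own head. Each transition is determined by the current state, the input letter consumed, and the two scanned worktape symbols; it changes the state and, on each worktape, overwrites the scanned symbol and moves the head one cell left, one cell right, or leaves it in place. The machine is real-time if it has no $\lambda$-transitions, i.e. every transition consumes exactly one input letter. A word is accepted if the computation reads the entire word and ends in a final state. $L(M)$ denotes the set of accepted words. A worktape is $1$-reversal-bounded if, on every accepting computation, its head makes at most $1$ change of direction between moving left and moving right (stay moves are ignored). *)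

(* Defs.v *)
From HB Require Import structures.
From mathcomp Require Import all_boot all_algebra.

Set Implicit Arguments.
Unset Strict Implicit.
Unset Printing Implicit Defensive.

Definition infixes (S : Type) (L : seq S -> Prop) (y : seq S) : Prop :=
  exists x z : seq S, L (x ++ y ++ z).

Definition dense (S : Type) (L : seq S -> Prop) : Prop :=
  forall y : seq S, infixes L y.

Inductive move := MoveLeft | MoveStay | MoveRight.

Definition nat_of_move (d : move) : nat :=
  match d with MoveLeft => 0 | MoveStay => 1 | MoveRight => 2 end.

Definition move_of_nat (n : nat) : move :=
  match n with 0 => MoveLeft | 1 => MoveStay | _ => MoveRight end.

Lemma nat_of_moveK : cancel nat_of_move move_of_nat.
Proof. by case. Qed.

HB.instance Definition _ := Equality.copy move (can_type nat_of_moveK).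

(* [delta q a g h] is the action in state [q] on input letter [a] when the two
   worktapes show [g] and [h]: the new state, then for each worktape the
   symbol written and the head move; the machine is stuck on [None].  As every
   transition consumes a letter, all these machines are real-time.  Both
   worktapes share one alphabet. *)
Record machine := Machine {
  state : finType;
  letter : finType;
  symbol : finType;
  start : state;
  blank : symbol;
  final : {set state};
  delta : state -> letter -> symbol -> symbol ->
          option (state * (symbol * move) * (symbol * move));
  letter_gt0 : 0 < #|letter|
}.

Record tape (G : Type) := Tape { head_pos : int; cell : int -> G }.

Definition scanned (G : Type) (t : tape G) : G := cell t (head_pos t).

Definition shift (d : move) (p : int) : int :=
  match d with
  | MoveLeft => (p - 1)%R
  | MoveStay => p
  | MoveRight => (p + 1)%R
  end.

Definition act (G : Type) (b : G * move) (t : tape G) : tape G :=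
  Tape (shift b.2 (head_pos t))
       (fun i => if i == head_pos t then b.1 else cell t i).

Record config (M : machine) := Config {
  cstate : state M;
  tape1 : tape (symbol M);
  tape2 : tape (symbol M)
}.

Definition init (M : machine) : config M :=
  let t := Tape 0%R (fun=> blank M) in Config (start M) t t.

(* [run c w] is the configuration reached from [c] by reading all of [w],
   together with the successive moves of the first and of the second head; it
   is [None] if the machine gets stuck before the end of [w]. *)
Fixpoint run (M : machine) (c : config M) (w : seq (letter M)) :
    option (seq move * seq move * config M) :=
  match w with
  | [::] => Some ([::], [::], c)
  | a :: w' =>
    match delta (cstate c) a (scanned (tape1 c)) (scanned (tape2 c)) with
    | None => None
    | Some (q, b1, b2) =>
      match run (Config q (act b1 (tape1 c)) (act b2 (tape2 c))) w' with
      | None => None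
      | Some (ds1, ds2, c') => Some (b1.2 :: ds1, b2.2 :: ds2, c')
      end
    end
  end.

Definition language (M : machine) (w : seq (letter M)) : Prop :=
  exists ds1 ds2 c,
    run (init M) w = Some (ds1, ds2, c) /\ cstate c \in final M.

Definition reversals (ds : seq move) : nat :=
  if [seq d <- ds | d != MoveStay] is d :: ds' then
    count id (pairmap (fun d1 d2 => d1 != d2) d ds')
  else 0.

Definition reversal_bounded (k : nat) (M : machine) : Prop :=
  forall w ds1 ds2 c,
    run (init M) w = Some (ds1, ds2, c) -> cstate c \in final M ->
    reversals ds1 <= k /\ reversals ds2 <= k.

(* The instruction list contains one item for each argument tuple on which
   [delta] is defined.  States, letters and symbols are represented by their
   ranks, and [CodeSeq.code] is a bijection from [seq nat] to [nat], so the code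
   determines the machine up to renaming of states, letters and symbols. *)
Definition encode_instr (M : machine)
    (t : state M * letter M * symbol M * symbol M) : option nat :=
  let: (q, a, g, h) := t in
  if delta q a g h is Some (q', (g', d1), (h', d2)) then
    Some (CodeSeq.code
      [:: enum_rank q : nat; enum_rank a : nat;
          enum_rank g : nat; enum_rank h : nat;
          enum_rank q' : nat;
          enum_rank g' : nat; nat_of_move d1;
          enum_rank h' : nat; nat_of_move d2])
  else None.

Definition encode (M : machine) : nat :=
  CodeSeq.code
    [:: #|state M|; #|letter M|; #|symbol M|;
        enum_rank (start M) : nat; enum_rank (blank M) : nat;
        CodeSeq.code [seq (enum_rank q : nat) | q <- enum (final M)];
        CodeSeq.code (pmap (@encode_instr M)
          (enum {: state M * letter M * symbol M * symbol M}))].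

(* Partial recursive functions.  Arities are not part of the syntax: a term
   applied to too few arguments is undefined, and superfluous arguments are
   ignored or passed on. *)
Inductive recfun :=
  | RZero
  | RSucc
  | RProj of nat
  | RComp of recfun & seq recfun
  | RPrec of recfun & recfun
  | RMin of recfun.

Inductive eval : recfun -> seq nat -> nat -> Prop :=
  | EvalZero v : eval RZero v 0
  | EvalSucc n v : eval RSucc (n :: v) n.+1
  | EvalProj i v : i < size v -> eval (RProj i) v (nth 0 v i)
  | EvalComp f gs v ys y :
      evals gs v ys -> eval f ys y -> eval (RComp f gs) v y
  | EvalPrec0 f g v y : eval f v y -> eval (RPrec f g) (0 :: v) y
  | EvalPrecS f g n v z y :
      eval (RPrec f g) (n :: v) z -> eval g [:: n, z & v] y ->
      eval (RPrec f g) (n.+1 :: v) y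
  | EvalMin f v n (h : nat -> nat) :
      (forall m, m < n -> eval f (m :: v) (h m).+1) -> eval f (n :: v) 0 ->
      eval (RMin f) v n
with evals : seq recfun -> seq nat -> seq nat -> Prop :=
  | EvalsNil v : evals [::] v [::]
  | EvalsCons g gs v y ys :
      eval g v y -> evals gs v ys -> evals (g :: gs) v (y :: ys).

(* Main.v *)
Require Import Defs.
From mathcomp Require Import all_boot all_algebra zify.

(* Every machine below has a language of the form [H Sigma^*], so that density
   amounts to [H] being nonempty.  A word of [H] guesses the letters dequeued by
   a deterministic queue machine; the first worktape records them, the second
   one records the enqueued letters, and the guesses are right if and only if
   both tapes agree when they are compared from right to left.  The queue
   machine runs a counter program, which computes a given recursive function.
   A decider [f] is refuted by self-reference.  The instructions of the fixed
   part of a machine have some code [A], and a chain of about [A] further states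
   puts [A] in unary on the queue.  Since [code (s ++ t)] is an affine function of
   [code t] whose coefficients can be read off [code s], the code of the whole
   machine is a recursive function of [A], the same for every fixed part.  The
   fixed part can thus be chosen to apply [f] to the code of the machine, and to
   accept if and only if the value is 0. *)

Set Implicit Arguments.
Unset Strict Implicit.
Unset Printing Implicit Defensive.

(** * Recursive functions as loop programs *)

Inductive star (T : Type) (step : T -> option T) : T -> T -> Prop :=
  | StarRefl x : star step x x
  | StarStep x y z : step x = Some y -> star step y z -> star step x z.

Lemma star_trans (T : Type) (step : T -> option T) x y z :
  star step x y -> star step y z -> star step x z.
Proof. by elim=> // x1 y1 z1 e _ IH /IH; apply: StarStep. Qed.

Lemma star_one (T : Type) (step : T -> option T) x y :
  step x = Some y -> star step x y.
Proof. by move=> e; apply: StarStep e (StarRefl _ _). Qed.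

Definition store := nat -> nat.

Definition upd (s : store) (r n : nat) : store :=
  fun i => if i == r then n else s i.

Lemma updE s r n i : upd s r n i = if i == r then n else s i.
Proof. by []. Qed.

Lemma upd_same s r n : upd s r n r = n.
Proof. by rewrite updE eqxx. Qed.

Lemma upd_neq s r n i : i != r -> upd s r n i = s i.
Proof. by rewrite updE => /negbTE->. Qed.

(** [Loop r c] is a while loop that decrements [r] before each pass. The body may set [r] again,
    which is what makes unbounded search possible. *)
Inductive cmd :=
  | Skip
  | Inc of nat
  | Seq of cmd & cmd
  | Loop of nat & cmd.

Inductive exec : cmd -> store -> store -> Prop :=
  | ExecSkip s : exec Skip s s
  | ExecInc r s : exec (Inc r) s (upd s r (s r).+1)
  | ExecSeq a b s1 s2 s3 : exec a s1 s2 -> exec b s2 s3 -> exec (Seq a b) s1 s3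
  | ExecLoop0 r c s : s r = 0 -> exec (Loop r c) s s
  | ExecLoopS r c n s1 s2 s3 :
      s1 r = n.+1 -> exec c (upd s1 r n) s2 -> exec (Loop r c) s2 s3 ->
      exec (Loop r c) s1 s3.

Definition wp (c : cmd) (s : store) (Q : store -> Prop) : Prop :=
  exists2 s', exec c s s' & Q s'.

Lemma wp_skip s (Q : store -> Prop) : Q s -> wp Skip s Q.
Proof. by exists s => //; apply: ExecSkip. Qed.

Lemma wp_inc r s (Q : store -> Prop) : Q (upd s r (s r).+1) -> wp (Inc r) s Q.
Proof. by eexists; [apply: ExecInc|]. Qed.

Lemma wp_seq a b s Q : wp a s (fun s' => wp b s' Q) -> wp (Seq a b) s Q.
Proof. by case=> s1 h1 [s2 h2 q]; exists s2 => //; apply: ExecSeq h1 h2. Qed.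

Lemma wp_imp c s (Q Q' : store -> Prop) :
  wp c s Q -> (forall s', Q s' -> Q' s') -> wp c s Q'.
Proof. by case=> s1 h q i; exists s1 => //; apply: i. Qed.

(** The index of the invariant is the value of the counter, hence the number of passes left. A body
    that refills the counter is outside this rule. *)
Lemma wp_loop r c (I : nat -> store -> Prop) (Q : store -> Prop) n s :
  I n s -> (forall n s, I n s -> s r = n) ->
  (forall n s, I n.+1 s -> wp c (upd s r n) (I n)) ->
  (forall s, I 0 s -> Q s) -> wp (Loop r c) s Q.
Proof.
move=> + Ir Ic IQ; elim: n s => [|n IH] s Is.
  by exists s; [apply: ExecLoop0; apply: Ir | apply: IQ].
have [s1 e1 /IH[s2 e2 q]] := Ic _ _ Is.
by exists s2 => //; apply: ExecLoopS (Ir _ _ Is) e1 e2.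
Qed.

Definition clear r := Loop r Skip.

Lemma wp_clear r s (Q : store -> Prop) :
  (forall s', s' r = 0 -> (forall i, i != r -> s' i = s i) -> Q s') ->
  wp (clear r) s Q.
Proof.
move=> q; apply: (wp_loop
  (I := fun n s' => s' r = n /\ forall i, i != r -> s' i = s i) (n := s r)).
- by [].
- by move=> n s' [].
- move=> n s' [_ e]; apply: wp_skip; split; first exact: upd_same.
  by move=> i ir; rewrite upd_neq ?e.
- by move=> s' [e0 e]; apply: q.
Qed.

(** Reading a register empties it, so [a] is drained into [b] and [t] together and then refilled
    from [t]. *)
Definition copy a b t :=
  Seq (clear b) (Seq (clear t)
    (Seq (Loop a (Seq (Inc b) (Inc t))) (Loop t (Inc a)))).

Lemma wp_copy a b t s (Q : store -> Prop) : a != b -> a != t -> b != t ->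
  (forall s', s' b = s a -> (forall i, i != b -> i != t -> s' i = s i) -> Q s') ->
  wp (copy a b t) s Q.
Proof.
move=> ab at_ bt q.
apply: wp_seq; apply: wp_clear => s1 s1b e1.
apply: wp_seq; apply: wp_clear => s2 s2t e2.
have s2b : s2 b = 0 by rewrite e2.
have s2e i : i != b -> i != t -> s2 i = s i by move=> ib it; rewrite e2 ?e1.
apply: wp_seq; apply: (wp_loop (n := s2 a) (I := fun n s' =>
  [/\ s' a = n, s' a + s' b = s a, s' t = s' b
    & forall i, i != a -> i != b -> i != t -> s' i = s i])).
- split=> // [||i _]; [by rewrite s2b addn0 s2e | by rewrite s2t | exact: s2e].
- by move=> n s' [].
- move=> n s' [s'a ab' tb' e']; apply: wp_seq; apply: wp_inc; apply: wp_inc.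
  rewrite !updE (negbTE ab) (negbTE at_) (negbTE bt) [t == b]eq_sym (negbTE bt).
  rewrite [b == a]eq_sym [t == a]eq_sym (negbTE ab) (negbTE at_) !eqxx.
  split=> //; [lia | by rewrite tb' |].
  by move=> i ia ib it; rewrite !updE (negbTE ia) (negbTE ib) (negbTE it) e'.
move=> s3 [s3a s3ab s3tb s3e].
apply: (wp_loop (n := s3 t) (I := fun n s' =>
  [/\ s' t = n, s' a + s' t = s a, s' b = s a
    & forall i, i != a -> i != b -> i != t -> s' i = s i])).
- by split=> //; lia.
- by move=> n s' [].
- move=> n s' [s't at' b' e']; apply: wp_inc; rewrite !updE.
  rewrite (negbTE at_) (negbTE bt) [t == a]eq_sym [b == a]eq_sym (negbTE ab).
  rewrite (negbTE at_) !eqxx.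
  split=> //; first lia.
  by move=> i ia ib it; rewrite !updE (negbTE ia) (negbTE it) e'.
- move=> s' [s't at' b' e']; apply: q => // i ib it.
  have [->|ia] := eqVneq i a; [lia | exact: e'].
Qed.

(* Register [out] receives the value of [f] at the contents of [args];
   registers from [fr] on are scratch. *)
Fixpoint compile (f : recfun) (args : seq nat) (out fr : nat) : cmd :=
  match f with
  | RZero => clear out
  | RSucc => if args is a :: _ then Seq (copy a out fr) (Inc out) else Skip
  | RProj i => copy (nth 0 args i) out fr
  | RComp f gs =>
      let m := size gs in
      let fix compile_all gs o :=
        if gs is g :: gs' then Seq (compile g args o (fr + m)) (compile_all gs' o.+1)
        else Skip in
      Seq (compile_all gs fr) (compile f (iota fr m) out (fr + m))
  | RPrec f g =>
      if args is a :: args' then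
        let: (i, k, z, t, fr') := (fr, fr.+1, fr.+2, fr.+3, fr.+4) in
        Seq (copy a i fr') (Seq (clear k) (Seq (compile f args' z fr')
          (Seq (Loop i (Seq (compile g [:: k, z & args'] t fr')
                         (Seq (copy t z fr') (Inc k))))
               (copy z out fr'))))
      else Skip
  | RMin f =>
      let c := compile f (fr :: args) fr.+1 fr.+2 in
      Seq (clear fr) (Seq c (Seq (Loop fr.+1 (Seq (Inc fr) c)) (copy fr out fr.+2)))
  end.

Fixpoint compile_all (gs : seq recfun) (args : seq nat) (o fr : nat) : cmd :=
  if gs is g :: gs' then Seq (compile g args o fr) (compile_all gs' args o.+1 fr)
  else Skip.

Lemma compile_comp f gs args out fr :
  compile (RComp f gs) args out fr =
  Seq (compile_all gs args fr (fr + size gs))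
      (compile f (iota fr (size gs)) out (fr + size gs)).
Proof.
rewrite /=; congr Seq; move: (fr + _) => fr'.
by elim: gs fr => //= g gs IH o; rewrite IH.
Qed.

Fixpoint all_prop (T : Type) (P : T -> Prop) (s : seq T) : Prop :=
  if s is x :: s' then P x /\ all_prop P s' else True.

(** The recursion is nested through [seq]: the case [RComp] needs a hypothesis for each listed
    function. *)
Lemma recfun_nested_ind (P : recfun -> Prop) :
  P RZero -> P RSucc -> (forall i, P (RProj i)) ->
  (forall f gs, P f -> all_prop P gs -> P (RComp f gs)) ->
  (forall f g, P f -> P g -> P (RPrec f g)) ->
  (forall f, P f -> P (RMin f)) -> forall f, P f.
Proof.
move=> p0 pS pi pc pp pm; fix IH 1; case=> [||i|f gs|f g|f].
- exact: p0.
- exact: pS.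
- exact: pi.
- apply: pc; first exact: IH.
  by elim: gs => [|g gs IHgs]; split; [apply: IH | apply: IHgs].
- by apply: pp; apply: IH.
- by apply: pm; apply: IH.
Qed.

(** The frame condition spares all registers below [fr] except [out]. The latter must not be an
    argument, since [copy] clears its target before reading its source. *)
Definition compiles (f : recfun) : Prop :=
  forall v y args out fr s (Q : store -> Prop), eval f v y ->
    map s args = v -> all (fun a => a < fr) args -> out < fr -> out \notin args ->
    (forall s', s' out = y -> (forall i, i < fr -> i != out -> s' i = s i) -> Q s') ->
    wp (compile f args out fr) s Q.

Lemma eval_inv f v y : eval f v y ->
  match f, v with
  | RZero, _ => y = 0
  | RSucc, n :: _ => y = n.+1
  | RProj i, _ => i < size v /\ y = nth 0 v i
  | RComp f gs, _ => exists2 ys, evals gs v ys & eval f ys y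
  | RPrec f g, 0 :: v => eval f v y
  | RPrec f g, n.+1 :: v =>
      exists2 z, eval (RPrec f g) (n :: v) z & eval g [:: n, z & v] y
  | RMin f, _ => exists2 h : nat -> nat,
      forall m, m < y -> eval f (m :: v) (h m).+1 & eval f (y :: v) 0
  | _, _ => False
  end.
Proof.
case=> {f v y} //.
- by move=> f gs v ys y; exists ys.
- by move=> f g n v z y; exists z.
- by move=> f v n h; exists h.
Qed.

Lemma evals_inv gs v ys : evals gs v ys ->
  match gs, ys with
  | [::], [::] => True
  | g :: gs, y :: ys => eval g v y /\ evals gs v ys
  | _, _ => False
  end.
Proof. by case. Qed.

(** Collecting the intermediate values in one function lets a loop invariant refer to the value
    after any number of passes. *)
Lemma eval_prec_values f g n v y : eval (RPrec f g) (n :: v) y ->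
  exists h : nat -> nat, [/\ eval f v (h 0), h n = y
    & forall i, i < n -> eval g [:: i, h i & v] (h i.+1)].
Proof.
elim: n y => [|n IH] y /eval_inv; first by exists (fun=> y); split.
case=> z /IH[h [h0 hn hi]] evg.
exists (fun i => if i == n.+1 then y else h i); split=> //.
  by rewrite eqxx.
move=> i le /=; rewrite eqSS (ltn_eqF le).
case: eqVneq le => [-> _|ni le]; first by rewrite hn.
by apply: hi; lia.
Qed.

Lemma map_upd_below (s s' : store) fr (args : seq nat) : all (fun a => a < fr) args ->
  (forall i, i < fr -> s' i = s i) -> map s' args = map s args.
Proof. by move=> /allP lt e; apply/eq_in_map => i /lt; apply: e. Qed.

Lemma all_ltn_le fr fr' (args : seq nat) : fr <= fr' ->
  all (fun a => a < fr) args -> all (fun a => a < fr') args.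
Proof. by move=> le; apply: sub_all => i h; apply: leq_trans h le. Qed.

Lemma notin_all_lt (fr a : nat) (args : seq nat) :
  all (fun a => a < fr) args -> fr <= a -> a \notin args.
Proof.
by move=> /allP lt le; apply/negP => /lt; rewrite ltnNge le.
Qed.

Lemma compile_all_correct gs v ys args o fr s (Q : store -> Prop) :
  all_prop compiles gs -> evals gs v ys ->
  map s args = v -> all (fun a => a < o) args -> o + size gs <= fr ->
  (forall s', map s' (iota o (size gs)) = ys ->
     (forall i, i < o -> s' i = s i) -> Q s') ->
  wp (compile_all gs args o fr) s Q.
Proof.
elim: gs ys o s Q => [|g gs IH] [|y ys] o s Q /= + /evals_inv.
- by move=> _ _ _ _ _ q; apply: wp_skip; apply: q.
- by [].
- by [].
case=> cg cgs [ev evs] sv lt le q; apply: wp_seq.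
apply: (cg _ _ _ _ _ _ _ ev) => //.
- by apply: all_ltn_le lt; lia.
- lia.
- by apply: notin_all_lt lt _.
move=> s1 s1o s1e; apply: (IH ys _ _ _ cgs) => //.
- rewrite (map_upd_below (s := s) lt) // => i io; apply: s1e; lia.
- exact: all_ltn_le lt.
- lia.
move=> s2 s2m s2e; apply: q => [|i io]; rewrite ?s2m s2e ?s1o // ?s1e //; lia.
Qed.

Lemma compile_correct f : compiles f.
Proof.
elim/recfun_nested_ind: f.
- move=> v y args out fr s Q /eval_inv-> sv lt ol oa q.
  by apply: wp_clear => s' s'0 e; apply: q => // i _; apply: e.
- move=> v y args out fr s Q /eval_inv + sv lt ol oa q.
  case: args sv lt oa => [<- //|a args] <- /= /andP[afr _].
  rewrite inE negb_or => /andP[oa _] yE.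
  apply: wp_seq; apply: wp_copy; try lia.
  move=> s1 s1o s1e; apply: wp_inc; apply: q.
    by rewrite upd_same s1o yE.
  by move=> i ifr io; rewrite upd_neq // s1e //; lia.
- move=> j v y args out fr s Q /eval_inv[+ ->] sv lt ol oa q.
  rewrite -sv size_map => ji.
  have ain := mem_nth 0 ji; have /= afr := allP lt _ ain.
  have ao : nth 0 args j != out by apply: contraNneq oa => <-.
  apply: wp_copy => //; try lia.
  move=> s1 s1o s1e; apply: q.
    by rewrite s1o -sv (nth_map 0).
  by move=> i ifr io; apply: s1e => //; lia.
- move=> f gs cf cgs v y args out fr s Q /eval_inv[ys evs ev] sv lt ol oa q.
  rewrite compile_comp; apply: wp_seq.
  apply: (compile_all_correct cgs evs) => // s1 s1m s1e.
  apply: (cf _ _ _ _ _ _ _ ev) => //.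
  + by apply/allP => i; rewrite mem_iota => /andP[].
  + lia.
  + by rewrite mem_iota; lia.
  by move=> s2 s2o s2e; apply: q => // i ifr io; rewrite s2e ?s1e //; lia.
- move=> f g cf cg v y args out fr s Q ev sv.
  case: args sv => [|a args] sv lt ol oa q.
    by rewrite -sv in ev; have := eval_inv ev.
  rewrite -sv /= in ev; have [h [h0 hn hi]] := eval_prec_values ev.
  move: lt oa => /= /andP[afr lt]; rewrite inE negb_or => /andP[oa oargs].
  have lt4 : all (fun a => a < fr.+4) args by apply: all_ltn_le lt; lia.
  apply: wp_seq; apply: wp_copy; try lia; move=> s1 s1i s1e.
  apply: wp_seq; apply: wp_clear => s2 s2k s2e.
  have e2 i : i < fr -> s2 i = s i by move=> ifr; rewrite s2e ?s1e; lia.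
  apply: wp_seq; apply: (cf _ _ _ _ _ _ _ h0) => //.
  + exact: map_upd_below lt e2.
  + by apply: notin_all_lt lt _; lia.
  move=> s3 s3z s3e.
  have e3 i : i < fr -> s3 i = s i by move=> ifr; rewrite s3e ?e2; lia.
  have s3i : s3 fr = s a by rewrite s3e ?s2e //; lia.
  have s3k : s3 fr.+1 = 0 by rewrite s3e //; lia.
  (* Register [fr] counts the passes left and [fr.+1] those done; [fr.+2] holds the value reached so
     far. *)
  apply: wp_seq; apply: (wp_loop (n := s a) (I := fun n s' =>
    [/\ s' fr = n, s' fr + s' fr.+1 = s a, s' fr.+2 = h (s' fr.+1)
      & forall i, i < fr -> s' i = s i])).
  + by split=> //; rewrite s3k ?s3i ?addn0.
  + by move=> n s' [].
  + move=> n s' [s'n s'k s'z s'e].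
    have ev' := hi (s' fr.+1) ltac:(lia).
    apply: wp_seq; apply: (cg _ _ _ _ _ _ _ ev').
    * rewrite /= !updE !gtn_eqF //; congr [:: _, _ & _]; rewrite ?s'z //.
      by apply: map_upd_below lt _ => i ifr; rewrite upd_neq ?s'e //; lia.
    * by rewrite /= lt4 andbT; lia.
    * lia.
    * by rewrite !inE !negb_or (notin_all_lt lt) ?andbT //; lia.
    move=> s4 s4t s4e; apply: wp_seq; apply: wp_copy; try lia.
    move=> s5 s5z s5e; apply: wp_inc.
    have s5k : s5 fr.+1 = s' fr.+1.
      by rewrite s5e ?s4e ?upd_neq //; lia.
    have s5i : s5 fr = n by rewrite s5e ?s4e ?upd_same //; lia.
    split.
    * by rewrite upd_neq ?s5i //; lia.
    * by rewrite upd_same upd_neq ?s5i ?s5k; lia.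
    * by rewrite upd_same upd_neq ?s5z ?s4t ?s5k //; lia.
    * by move=> i ifr; rewrite upd_neq ?s5e ?s4e ?upd_neq ?s'e //; lia.
  move=> s4 [s4i s4k s4z s4e].
  apply: wp_copy; try lia.
  move=> s5 s5o s5e; apply: q; first by rewrite s5o s4z -hn; congr h; lia.
  by move=> i ifr io; rewrite s5e ?s4e //; lia.
- move=> f cf v y args out fr s Q /eval_inv[h hpos h0] sv lt ol oa q.
  apply: wp_seq; apply: wp_clear => s1 s1n s1e.
  have e1 i : i < fr -> s1 i = s i by move=> ifr; rewrite s1e; lia.
  have lt2 : all (fun a => a < fr.+2) args by apply: all_ltn_le lt; lia.
  pose h' m := if m < y then (h m).+1 else 0.
  have evh m : m <= y -> eval f (m :: v) (h' m).
    rewrite /h' leq_eqVlt => /orP[/eqP->|lm]; first by rewrite ltnn.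
    by rewrite lm; apply: hpos.
  have step m s' (Q' : store -> Prop) : m <= y -> s' fr = m ->
      (forall i, i < fr -> s' i = s i) ->
      (forall s'', s'' fr = m -> s'' fr.+1 = h' m ->
        (forall i, i < fr -> s'' i = s i) -> Q' s'') ->
      wp (compile f (fr :: args) fr.+1 fr.+2) s' Q'.
    move=> my s'm s'e q'; apply: (cf _ _ _ _ _ _ _ (evh m my)).
    + by rewrite /= s'm; congr cons; rewrite -sv; apply: map_upd_below lt s'e.
    + by rewrite /= lt2 andbT; lia.
    + lia.
    + by rewrite inE negb_or (notin_all_lt lt) ?andbT //; lia.
    move=> s2 s2o s2e; apply: q' => //; first by rewrite s2e ?s'm //; lia.
    by move=> i ifr; rewrite s2e ?s'e //; lia.
  apply: wp_seq; apply: (step 0) => // s2 s2n s2y s2e.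
  (* The body refills the tested register, so [wp_loop] does not apply. The induction is on the
     distance [d] from the candidate [m] to [y]. *)
  have looped : forall d m s', m + d = y -> s' fr = m -> s' fr.+1 = h' m ->
      (forall i, i < fr -> s' i = s i) ->
      wp (Loop fr.+1 (Seq (Inc fr) (compile f (fr :: args) fr.+1 fr.+2))) s'
        (fun s'' => s'' fr = y /\ forall i, i < fr -> s'' i = s i).
    elim=> [|d IH] m s' md s'm s'y s'e.
      exists s'; last by split=> //; lia.
      by apply: ExecLoop0; rewrite s'y /h' (_ : m = y) ?ltnn //; lia.
    have my : m < y by lia.
    have [s3 ex [s3n [s3y s3e]]] : wp (Seq (Inc fr)
        (compile f (fr :: args) fr.+1 fr.+2)) (upd s' fr.+1 (h m))
        (fun s'' => s'' fr = m.+1 /\ s'' fr.+1 = h' m.+1 /\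
           forall i, i < fr -> s'' i = s i).
      apply: wp_seq; apply: wp_inc; apply: (step m.+1) => //.
      + by rewrite upd_same upd_neq ?s'm //; lia.
      + by move=> i ifr; rewrite !upd_neq ?s'e //; lia.
    have [|s4 ex' q4] := IH m.+1 s3 _ s3n s3y s3e; first lia.
    by exists s4 => //; apply: ExecLoopS ex ex'; rewrite s'y /h' my.
  apply: wp_seq; apply: wp_imp (looped y 0 s2 _ s2n s2y s2e) _ => //.
  move=> s3 [s3n s3e]; apply: wp_copy; try lia.
  move=> s4 s4o s4e; apply: q; first by rewrite s4o.
  by move=> i ifr io; rewrite s4e ?s3e //; lia.
Qed.

(** * Counter programs on a queue *)

(* An address outside the program is a crash, as opposed to [CHalt]. *)
Inductive instr :=
  | CStart
  | CHalt
  | CInc of nat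
  | CDec of nat & nat
  | CJmp of nat.

Definition fetch (prog : seq instr) (pc : nat) : option instr :=
  nth None (map Some prog) pc.

Definition cstep (prog : seq instr) (c : nat * store) : option (nat * store) :=
  let: (pc, s) := c in
  match fetch prog pc with
  | Some (CInc r) => Some (pc.+1, upd s r (s r).+1)
  | Some (CDec r l) =>
      if s r is n.+1 then Some (pc.+1, upd s r n) else Some (l, s)
  | Some (CJmp l) => Some (l, s)
  | _ => None
  end.

(** Here [p] is the address of the first instruction. A loop is a test, its body and a jump back, so
    its exit is at [p + (size body).+2]. *)
Fixpoint flat (c : cmd) (p : nat) : seq instr :=
  match c with
  | Skip => [::]
  | Inc r => [:: CInc r]
  | Seq a b => let ca := flat a p in ca ++ flat b (p + size ca)
  | Loop r c =>
      let body := flat c p.+1 in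
      CDec r (p + (size body).+2) :: body ++ [:: CJmp p]
  end.

Fixpoint code_at (prog : seq instr) (p : nat) (l : seq instr) : Prop :=
  if l is i :: l' then fetch prog p = Some i /\ code_at prog p.+1 l' else True.

Lemma code_at_cat prog p l1 l2 :
  code_at prog p (l1 ++ l2) <-> code_at prog p l1 /\ code_at prog (p + size l1) l2.
Proof.
elim: l1 p => [|i l1 IH] p /=; first by rewrite addn0; split=> [|[]].
rewrite IH addSnnS; tauto.
Qed.

Lemma code_at_mid pre l post : code_at (pre ++ l ++ post) (size pre) l.
Proof.
elim: l pre => //= i l IH pre; split.
  by rewrite /fetch map_cat nth_cat size_map ltnn subnn.
by have := IH (rcons pre i); rewrite size_rcons cat_rcons.
Qed.

Lemma exec_flat prog c s s' : exec c s s' -> forall p, code_at prog p (flat c p) ->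
  star (cstep prog) (p, s) (p + size (flat c p), s').
Proof.
elim=> {c s s'} /=.
- by move=> s p _; rewrite addn0; apply: StarRefl.
- by move=> r s p [e _]; rewrite addn1; apply: star_one; rewrite /= e.
- move=> a b s1 s2 s3 _ IHa _ IHb p /code_at_cat[/IHa ha /IHb hb].
  by rewrite size_cat addnA; apply: star_trans ha hb.
- move=> r c s s0 p [e _]; apply: star_one; rewrite /= e s0 size_cat /=.
  by rewrite addn1.
- move=> r c n s1 s2 s3 s1r _ IHc _ IHl p [e /code_at_cat[hc [ej _]]].
  apply: StarStep (_ : _ = Some (p.+1, upd s1 r n)) _.
    by rewrite /= e s1r.
  apply: star_trans (IHc _ hc) _.
  apply: StarStep (_ : _ = Some (p, s2)) _; first by rewrite /= ej.
  by apply: IHl; split=> //; apply/code_at_cat.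
Qed.

(* The rules of a deterministic machine with a FIFO queue of booleans; [Read]
   dequeues a letter, on which the new state and the enqueued letter depend. *)
Inductive rule (Q : Type) :=
  | Stop
  | Silent of Q & option bool
  | Read of (bool -> Q * option bool).
Arguments Stop {Q}.

Definition oseq (T : Type) (o : option T) : seq T :=
  if o is Some x then [:: x] else [::].

Definition qstep (Q : Type) (R : Q -> rule Q) (c : Q * seq bool) :
    option (Q * seq bool) :=
  let: (q, w) := c in
  match R q with
  | Stop => None
  | Silent q' o => Some (q', w ++ oseq o)
  | Read f =>
      if w is a :: w' then Some ((f a).1, w' ++ oseq (f a).2) else None
  end.

(* A store is kept on the queue as the [k] blocks [1^(s 0) 0], ..., [1^(s k.-1) 0].
   State [Some (pc, j, b)] copies the blocks from the [j]-th on, while executing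
   the instruction at [pc]; [b] tells that its register has been modified. *)
Definition qstate : Type := option (nat * nat * bool).

(** One rotation of the queue: the blocks pass from the front to the rear, and then control moves to
    [next]. *)
Definition copy_rule (k pc next j : nat) (b : bool) : rule qstate :=
  if j == k then Silent (Some (next, 0, false)) None
  else Read (fun a => (Some (pc, if a then j else j.+1, b), Some a)).

(** [CInc] enqueues an extra [true] ahead of block [r], and [CDec] swallows one; on an empty block
    [b] stays false, which selects the jump at the end of the rotation. [CStart] appends [k]
    delimiters, and [CHalt] empties the queue and ends in [None]. *)
Definition instr_rule (k : nat) (i : instr) (pc j : nat) (b : bool) : rule qstate :=
  match i with
  | CStart =>
      if j == k then Silent (Some (2, 0, false)) None
      else Silent (Some (pc, j.+1, b)) (Some false)
  | CHalt =>
      if j == k then Silent None None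
      else Read (fun a => (Some (pc, if a then j else j.+1, b), None))
  | CInc r =>
      if (j == r) && ~~ b then Silent (Some (pc, j, true)) (Some true)
      else copy_rule k pc pc.+1 j b
  | CDec r l =>
      if (j == r) && ~~ b then
        Read (fun a => if a then (Some (pc, j, true), None)
                       else (Some (pc, j.+1, false), Some false))
      else copy_rule k pc (if b then pc.+1 else l) j b
  | CJmp l => copy_rule k pc l j b
  end.

Definition qrule (k : nat) (prog : seq instr) (x : qstate) : rule qstate :=
  if x is Some (pc, j, b) then
    if j <= k then oapp (fun i => instr_rule k i pc j b) Stop (fetch prog pc) else Stop
  else Stop.

Definition block (n : nat) : seq bool := nseq n true ++ [:: false].

Definition blocks (s : store) (j n : nat) : seq bool :=
  flatten [seq block (s r) | r <- iota j n].

Lemma blocks_cat s j m n : blocks s j (m + n) = blocks s j m ++ blocks s (j + m) n.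
Proof. by rewrite /blocks iotaD map_cat flatten_cat. Qed.

Lemma blocksS s j n : blocks s j n.+1 = block (s j) ++ blocks s j.+1 n.
Proof. by []. Qed.

Lemma eq_blocks s s' j n : (forall i, j <= i < j + n -> s i = s' i) ->
  blocks s j n = blocks s' j n.
Proof.
by move=> e; congr flatten; apply/eq_in_map => i; rewrite mem_iota => /e->.
Qed.

Definition regs_below (k : nat) (prog : seq instr) : bool :=
  all (fun i => match i with CInc r | CDec r _ => r < k | _ => true end) prog.

Lemma fetch_below k prog pc i : regs_below k prog -> fetch prog pc = Some i ->
  match i with CInc r | CDec r _ => r < k | _ => true end.
Proof.
rewrite /fetch => /(all_nthP CStart) h e.
have lt : pc < size prog.
  by rewrite ltnNge; apply/negP => ge; move: e; rewrite nth_default ?size_map.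
by move: e; rewrite (nth_map CStart) // => -[<-]; apply: h.
Qed.

Lemma copy_block (R : qstate -> rule qstate) pc j b n Y :
  R (Some (pc, j, b)) =
    Read (fun a => (Some (pc, if a then j else j.+1, b), Some a)) ->
  star (qstep R) (Some (pc, j, b), block n ++ Y) (Some (pc, j.+1, b), Y ++ block n).
Proof.
move=> e; elim: n Y => [|n IH] Y; first by apply: star_one; rewrite /= e.
apply: StarStep (_ : _ = Some (Some (pc, j, b), (block n ++ Y) ++ [:: true])) _.
  by rewrite /= e.
by have := IH (Y ++ [:: true]); rewrite -!catA.
Qed.

Lemma copy_blocks (R : qstate -> rule qstate) s pc j b n Y :
  (forall i, j <= i < j + n -> R (Some (pc, i, b)) =
    Read (fun a => (Some (pc, if a then i else i.+1, b), Some a))) ->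
  star (qstep R) (Some (pc, j, b), blocks s j n ++ Y)
                 (Some (pc, j + n, b), Y ++ blocks s j n).
Proof.
elim: n j Y => [|n IH] j Y e.
  by rewrite addn0 /blocks /= cats0; apply: StarRefl.
rewrite blocksS -catA; apply: star_trans (copy_block _ _ _) _.
  by apply: e; lia.
rewrite -!catA.
have := IH j.+1 (Y ++ block (s j)); rewrite addSnnS -!catA; apply.
by move=> i ij; apply: e; lia.
Qed.

Lemma qrule_fetch k prog pc j b i : fetch prog pc = Some i -> j <= k ->
  qrule k prog (Some (pc, j, b)) = instr_rule k i pc j b.
Proof. by rewrite /qrule => -> ->. Qed.

Lemma blocks_split s r k : r < k ->
  blocks s 0 k = blocks s 0 r ++ block (s r) ++ blocks s r.+1 (k - r.+1).
Proof.
move=> rk; rewrite -{1}(_ : r + (k - r.+1).+1 = k); last lia.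
by rewrite blocks_cat add0n blocksS.
Qed.

Lemma blocks_upd s r n k : r < k ->
  blocks (upd s r n) 0 k = blocks s 0 r ++ block n ++ blocks s r.+1 (k - r.+1).
Proof.
move=> rk; rewrite (blocks_split _ rk) upd_same.
by congr (_ ++ (_ ++ _)); apply: eq_blocks => i ir; rewrite upd_neq //; lia.
Qed.

Lemma cstep_queue k prog pc s pc' s' : regs_below k prog ->
  cstep prog (pc, s) = Some (pc', s') ->
  star (qstep (qrule k prog)) (Some (pc, 0, false), blocks s 0 k)
                              (Some (pc', 0, false), blocks s' 0 k).
Proof.
move=> wf; case ef: (fetch prog pc) => [i|]; last by rewrite /= ef.
have iE := qrule_fetch _ ef; have := fetch_below wf ef.
have finish b l : qrule k prog (Some (pc, k, b)) = copy_rule k pc l k b ->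
    star (qstep (qrule k prog)) (Some (pc, k, b), blocks s' 0 k)
      (Some (l, 0, false), blocks s' 0 k).
  by move=> e; apply: star_one; rewrite /qstep e /copy_rule eqxx cats0.
case: i ef iE => [||r|r l|l] ef iE; rewrite /= ef // => rk.
- case=> <- s'E; rewrite (blocks_split _ rk).
  apply: star_trans (copy_blocks _ _ _) _ => [i ir|].
    by rewrite iE /= /copy_rule ?ltn_eqF //; lia.
  (* The extra [true] reaches the rear before block [r] is copied behind it, so the block grows by
     one. *)
  apply: StarStep (_ : _ = Some (Some (pc, r, true),
      block (s r) ++ (blocks s r.+1 (k - r.+1) ++ blocks s 0 r ++ [:: true]))) _.
    by rewrite /qstep add0n iE ?(ltnW rk) //= eqxx /= -!catA.
  apply: star_trans (copy_block _ _ _) _.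
    by rewrite iE ?(ltnW rk) //= andbF /copy_rule (ltn_eqF rk).
  rewrite -!catA; apply: star_trans (copy_blocks _ _ _) _ => [i ir|].
    by rewrite iE /= ?andbF /copy_rule ?ltn_eqF //; lia.
  have := finish true pc.+1; rewrite subnKC // -s'E blocks_upd //.
  rewrite -catA; apply.
  by rewrite iE //= andbF.
- case sr: (s r) => [|n] [<- s'E]; rewrite (blocks_split _ rk) sr.
  + apply: star_trans (copy_blocks _ _ _) _ => [i ir|].
      by rewrite iE /= /copy_rule ?ltn_eqF //; lia.
    apply: StarStep (_ : _ = Some (Some (pc, r.+1, false),
        blocks s r.+1 (k - r.+1) ++ (blocks s 0 r ++ block 0))) _.
      by rewrite /qstep add0n iE ?(ltnW rk) //= eqxx /= -!catA.
    apply: star_trans (copy_blocks _ _ _) _ => [i ir|].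
      by rewrite iE /= ?gtn_eqF /copy_rule ?ltn_eqF //; lia.
    have := finish false l; rewrite subnKC // -s'E (blocks_split _ rk) sr -!catA.
    by apply; rewrite iE //= gtn_eqF.
  + apply: star_trans (copy_blocks _ _ _) _ => [i ir|].
      by rewrite iE /= /copy_rule ?ltn_eqF //; lia.
    apply: StarStep (_ : _ = Some (Some (pc, r, true),
        block n ++ (blocks s r.+1 (k - r.+1) ++ blocks s 0 r))) _.
      by rewrite /qstep add0n iE ?(ltnW rk) //= eqxx /= cats0 -!catA.
    apply: star_trans (copy_block _ _ _) _.
      by rewrite iE ?(ltnW rk) //= andbF /copy_rule (ltn_eqF rk).
    rewrite -!catA; apply: star_trans (copy_blocks _ _ _) _ => [i ir|].
      by rewrite iE /= ?andbF /copy_rule ?ltn_eqF //; lia.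
    have := finish true pc.+1; rewrite subnKC // -s'E blocks_upd // -!catA.
    by apply; rewrite iE //= andbF.
- case=> <- s'E; rewrite -[blocks s 0 k]cats0.
  apply: star_trans (copy_blocks _ _ _) _ => [i ir|].
    by rewrite iE /= /copy_rule ?ltn_eqF //; lia.
  by have := finish false l; rewrite s'E; apply; rewrite iE.
Qed.

Lemma cstar_queue k prog c c' : regs_below k prog -> star (cstep prog) c c' ->
  star (qstep (qrule k prog)) (Some (c.1, 0, false), blocks c.2 0 k)
                              (Some (c'.1, 0, false), blocks c'.2 0 k).
Proof.
move=> wf; elim=> [x|x y z e _ IH]; first exact: StarRefl.
by case: x y e IH => [p s] [p' s'] /(cstep_queue wf) h IH; apply: star_trans h IH.
Qed.

(** The word of [A] letters [true] and [k] delimiters consists of the blocks of the store with [A]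
    in register 0 and zeros elsewhere. *)
Lemma start_queue k prog pc A : fetch prog pc = Some CStart -> 0 < k ->
  star (qstep (qrule k prog)) (Some (pc, 0, false), nseq A true)
    (Some (2, 0, false), blocks (upd (fun=> 0) 0 A) 0 k).
Proof.
move=> ef k0; have iE := qrule_fetch _ ef.
have zeros j n : blocks (fun=> 0) j n = nseq n false.
  by elim: n j => // n IH j; rewrite blocksS IH.
suff h : forall j Y, j <= k -> star (qstep (qrule k prog)) (Some (pc, j, false), Y)
    (Some (2, 0, false), Y ++ nseq (k - j) false).
  have := h 0 (nseq A true) isT; rewrite blocks_upd // !zeros -catA.
  by rewrite subn0 subn1 -{2}(prednK k0).
move=> j Y jk; move: {-2}(k - j) (erefl (k - j)) => d.
elim: d j Y jk => [|d IH] j Y jk dE.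
  have jk' : j = k by lia.
  by apply: star_one; rewrite jk' /qstep iE // /instr_rule eqxx.
apply: StarStep (_ : _ = Some (Some (pc, j.+1, false), Y ++ [:: false])) _.
  by rewrite /qstep iE // /instr_rule ltn_eqF //; lia.
by rewrite -[nseq _ _]cat1s catA; apply: IH; lia.
Qed.

Lemma halt_queue k prog pc s : fetch prog pc = Some CHalt ->
  star (qstep (qrule k prog)) (Some (pc, 0, false), blocks s 0 k) (None, [::]).
Proof.
move=> ef; have iE := qrule_fetch _ ef.
suff h : forall d j, j + d = k ->
    star (qstep (qrule k prog)) (Some (pc, j, false), blocks s j d) (None, [::]).
  exact: h.
elim=> [|d IH] j jk.
  have jk' : j = k by lia.
  by apply: star_one; rewrite jk' /qstep iE // /instr_rule eqxx.
rewrite /blocks /=; elim: (s j) => [|n IHn].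
  apply: StarStep (IH j.+1 _); last lia.
  by rewrite /qstep iE /instr_rule ?ltn_eqF //= ?cats0 //; lia.
apply: StarStep IHn.
by rewrite /qstep iE /instr_rule ?ltn_eqF //= ?cats0 //; lia.
Qed.

(** * Queue machines on two one-turn worktapes *)

Definition map_rule (Q Q' : Type) (f : Q -> Q') (r : rule Q) : rule Q' :=
  match r with
  | Stop => Stop
  | Silent q o => Silent (f q) o
  | Read n => Read (fun a => (f (n a).1, (n a).2))
  end.

(* States 0, 1 and 2 of the Turing machine are the accepting sink, the
   comparison of the two tapes, and the turn that precedes it. *)
Definition rank (sts : seq (nat * nat * bool)) (x : qstate) : nat :=
  if x is Some y then (index y sts).+3 else 2.

Definition ranked_rule (R : qstate -> rule qstate) (sts : seq (nat * nat * bool))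
    (q : nat) : rule nat :=
  if q is i.+3 then
    if i < size sts then map_rule (rank sts) (R (Some (nth (0, 0, false) sts i)))
    else Stop
  else Stop.

Lemma ranked_ruleE R sts x : (forall y, y \notin sts -> R (Some y) = Stop) ->
  R None = Stop -> ranked_rule R sts (rank sts x) = map_rule (rank sts) (R x).
Proof.
move=> out; case: x => [y|] /= [e]; last by rewrite e.
rewrite index_mem; case: ifP => [yin|/negbT/out-> //].
by rewrite nth_index.
Qed.

Lemma rank_ltn sts x : rank sts x < (size sts).+4.
Proof. by case: x => //= y; rewrite !ltnS index_size. Qed.

Lemma star_ranked R sts c d (R' : nat -> rule nat) :
  (forall y, y \notin sts -> R (Some y) = Stop) -> R None = Stop ->
  (forall q, q < (size sts).+4 -> R' q = ranked_rule R sts q) ->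
  star (qstep R) c d -> star (qstep R') (rank sts c.1, c.2) (rank sts d.1, d.2).
Proof.
move=> out none ext; elim=> [x|[x w] y z e _ IH]; first exact: StarRefl.
apply: StarStep IH; move: e => /=.
rewrite (ext _ (rank_ltn sts x)) ranked_ruleE //.
case: (R x) => //= [q o [<-] //|f].
by case: w => // a w [<-].
Qed.

(* States from [A] on form a chain that enqueues [q - A] letters when started
   in [q]. *)
Definition chain_rule (R : nat -> rule nat) (A q : nat) : rule nat :=
  if q < A then R q
  else if q == A then Silent 3 None
  else Silent q.-1 (Some true).

Lemma chain_queue R A n w : star (qstep (chain_rule R A)) (A + n, w)
  (3, w ++ nseq n true).
Proof.
elim: n w => [|n IH] w.
  by apply: star_one; rewrite /= /chain_rule addn0 ltnn eqxx.
apply: StarStep (_ : _ = Some (A + n, w ++ [:: true])) _.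
  by rewrite /qstep /chain_rule ltnNge leq_addr addnS gtn_eqF // ltnS leq_addr.
by have := IH (w ++ [:: true]); rewrite -catA.
Qed.

(** During the simulation the heads are on blanks, so [None], written without a move, changes
    nothing. *)
Definition write (o : option bool) : option bool * move :=
  if o is Some x then (Some x, MoveRight) else (None, MoveStay).

(** States from 3 on simulate the queue machine, state 2 moves both heads onto the last letters, and
    state 1 compares leftwards until both tapes show a blank. A silent rule has to consume a letter
    as well, and accepts only [true]. *)
Definition action (R : nat -> rule nat) (q : nat) (a : bool) (g h : option bool) :
    option (nat * (option bool * move) * (option bool * move)) :=
  match q, g, h with
  | 0, None, None => Some (0, write None, write None)
  | 1, None, None => Some (0, write None, write None)
  | 1, Some x, Some y =>
      if x == y then Some (1, (g, MoveLeft), (h, MoveLeft)) else None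
  | 2, None, None => Some (1, (g, MoveLeft), (h, MoveLeft))
  | _.+3, None, None =>
      match R q with
      | Stop => None
      | Silent q' o => if a then Some (q', write None, write o) else None
      | Read f => Some ((f a).1, write (Some a), write (f a).2)
      end
  | _, _, _ => None
  end.

Lemma card_bool_gt0 : 0 < #|{: bool}|.
Proof. by rewrite card_bool. Qed.

(* The first tape receives the dequeued letters and the second tape the
   enqueued ones; the input supplies guesses of the dequeued letters, which are
   right if and only if both tapes are equal in the end. *)
Definition qmachine (R : nat -> rule nat) (N : nat) : machine :=
  @Machine 'I_N.+1 bool (option bool) ord_max None [set ord0]
    (fun q a g h => omap (fun x => (inord x.1.1, x.1.2, x.2)) (action R q a g h))
    card_bool_gt0.

(** * Accepted words of the simulating machine *)

Definition accepts (M : machine) (c : config M) (w : seq (letter M)) : Prop :=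
  exists ds1 ds2 c', run c w = Some (ds1, ds2, c') /\ cstate c' \in final M.

Lemma accepts_cons (M : machine) (c : config M) a w : accepts c (a :: w) <->
  if delta (cstate c) a (scanned (tape1 c)) (scanned (tape2 c)) is Some (q, b1, b2)
  then accepts (Config q (act b1 (tape1 c)) (act b2 (tape2 c))) w else False.
Proof.
rewrite /accepts /=; case: delta => [[[q b1] b2]|]; last by split=> // -[? [? [? []]]].
split=> [[ds1 [ds2 [c' []]]]|[ds1 [ds2 [c' [e f]]]]].
  by case: run => // -[[d1 d2] c1] [_ _ <-]; exists d1, d2, c1.
by exists (b1.2 :: ds1), (b2.2 :: ds2), c'; rewrite e.
Qed.

Definition acc (R : nat -> rule nat) (N q : nat) (t1 t2 : tape (option bool))
    (w : seq bool) : Prop :=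
  @accepts (qmachine R N) (@Config (qmachine R N) (inord q) t1 t2) w.

Lemma acc_nil R N q t1 t2 : q <= N -> acc R N q t1 t2 [::] <-> q = 0.
Proof.
move=> qN; rewrite /acc /accepts /=; split.
  case=> ds1 [ds2 [c' [[_ _ <-]]]] /=; rewrite inE => /eqP/(congr1 val) /=.
  by rewrite inordK.
move=> ->; exists [::], [::], (@Config (qmachine R N) (inord 0) t1 t2); split=> //.
by rewrite inE; apply/eqP/val_inj; rewrite /= inordK.
Qed.

Lemma acc_cons R N q t1 t2 a w : q <= N -> acc R N q t1 t2 (a :: w) <->
  if action R q a (scanned t1) (scanned t2) is Some (q', b1, b2)
  then acc R N q' (act b1 t1) (act b2 t2) w else False.
Proof.
move=> qN; rewrite /acc accepts_cons /= inordK //.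
by case: action => // -[[q' b1] b2].
Qed.

(** The list [s] is the tape read from right to left: its first letter is in cell [size s - 1], its
    last one in cell 0, and the blank in cell -1 ends the comparison. *)
Fixpoint stack (cell : int -> option bool) (s : seq bool) : Prop :=
  if s is x :: s' then cell (size s') = Some x /\ stack cell s'
  else cell (-1)%R = None.

Lemma eq_stack (c c' : int -> option bool) s :
  (forall i : int, (i < size s)%R -> c i = c' i) -> stack c s -> stack c' s.
Proof.
elim: s => [|x s IH] /= e; first by rewrite e.
by case=> cx cs; split; [rewrite -e //; lia | apply: IH => // i il; apply: e; lia].
Qed.

(* The head is on the first blank after the written word, which is the
   reverse of [s]. *)
Definition wtape (t : tape (option bool)) (s : seq bool) : Prop :=
  [/\ head_pos t = size s, stack (cell t) s
    & forall n : nat, size s <= n -> cell t n = None].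

(* The head is on the last letter of the word that remains to be compared. *)
Definition ctape (t : tape (option bool)) (s : seq bool) : Prop :=
  head_pos t = (Posz (size s) - 1)%R /\ stack (cell t) s.

Lemma wtape_scanned t s : wtape t s -> scanned t = None.
Proof. by case=> h _ b; rewrite /scanned h; apply: b. Qed.

Lemma wtape_write t s o : wtape t s -> wtape (act (write o) t) (oseq o ++ s).
Proof.
case=> h st b; rewrite /act; case: o => [x|] /=; split=> /=.
- by rewrite h; lia.
- rewrite h eqxx; split=> //; apply: eq_stack st => i il; case: eqP => //; lia.
- by move=> n ln; rewrite h; case: eqP => [|_]; [lia | apply: b; lia].
- by [].
- by apply: eq_stack st => i il; rewrite h; case: eqP => //; lia.
- by move=> n ln; case: eqP => // _; apply: b.
Qed.

Lemma wtape_turn t s g : wtape t s -> ctape (act (g, MoveLeft) t) s.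
Proof.
case=> h st _; split; rewrite /= ?h //.
by apply: eq_stack st => i il; case: eqP => //; lia.
Qed.

Lemma ctape_scanned t s : ctape t s -> scanned t = ohead s.
Proof.
case=> h; rewrite /scanned h; case: s {h} => //= x s [+ _].
by rewrite (_ : (Posz (size s).+1 - 1)%R = size s) //; lia.
Qed.

Lemma ctape_left t x s g : ctape t (x :: s) -> ctape (act (g, MoveLeft) t) s.
Proof.
case=> h [_ st]; split; rewrite /= h /=; first lia.
by apply: eq_stack st => i il; case: eqP => //=; lia.
Qed.

Lemma acc_sink R N t1 t2 w : scanned t1 = None -> scanned t2 = None ->
  acc R N 0 t1 t2 w.
Proof.
elim: w t1 t2 => [|a w IH] t1 t2 e1 e2; first exact/acc_nil.
by apply/acc_cons; rewrite // e1 e2 /=; apply: IH; rewrite /scanned /= eqxx.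
Qed.

Lemma acc_compare R N t1 t2 s w : 0 < N -> ctape t1 s -> ctape t2 s ->
  size s < size w -> acc R N 1 t1 t2 w.
Proof.
move=> N0; elim: s t1 t2 w => [|x s IH] t1 t2 [|a w] c1 c2 //= lt;
  apply/acc_cons; rewrite // (ctape_scanned c1) (ctape_scanned c2) //=.
  by apply: acc_sink; rewrite /scanned /= eqxx.
by rewrite eqxx; apply: IH lt; [apply: ctape_left c1 | apply: ctape_left c2].
Qed.

Lemma acc_compare_eq R N t1 t2 s1 s2 w : 0 < N -> ctape t1 s1 -> ctape t2 s2 ->
  acc R N 1 t1 t2 w -> s1 = s2.
Proof.
move=> N0; elim: w t1 t2 s1 s2 => [|a w IH] t1 t2 s1 s2 c1 c2.
  by move/acc_nil=> /(_ N0).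
move/acc_cons => /(_ N0); rewrite (ctape_scanned c1) (ctape_scanned c2).
case: s1 s2 c1 c2 => [|x s1] [|y s2] c1 c2 //=.
case: eqP => // -> /IH h; congr cons.
by apply: h; [apply: ctape_left c1 | apply: ctape_left c2].
Qed.

(** No rule leads to state 0 or 1, so the simulation reaches the sink only through the turn and the
    comparison. The bound [N] makes [inord] faithful. *)
Definition wf_rules (R : nat -> rule nat) (N : nat) : Prop :=
  (forall q, q < 3 -> R q = Stop) /\
  forall q, q <= N -> match R q with
    | Stop => True
    | Silent q' _ => 2 <= q' <= N
    | Read f => forall a, 2 <= (f a).1 <= N
    end.

Lemma acc_write R N q t1 t2 s1 s2 a w : 2 < q <= N ->
  wtape t1 s1 -> wtape t2 s2 -> acc R N q t1 t2 (a :: w) <->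
  match R q with
  | Stop => False
  | Silent q' o =>
      if a then acc R N q' (act (write None) t1) (act (write o) t2) w else False
  | Read f =>
      acc R N (f a).1 (act (write (Some a)) t1) (act (write (f a).2) t2) w
  end.
Proof.
move=> /andP[q3 qN] w1 w2; rewrite acc_cons // (wtape_scanned w1) (wtape_scanned w2).
case: q q3 {qN} => [|[|[|q]]] //= _; case: (R _) => // q' o.
by case: a.
Qed.

(** Before the turn both tapes only grow, and acceptance requires equal contents at the turn; so the
    present contents extend to one common word. *)
Lemma acc_writing_eq R N q t1 t2 s1 s2 w : wf_rules R N -> 2 <= q <= N ->
  wtape t1 s1 -> wtape t2 s2 -> acc R N q t1 t2 w ->
  exists u1 u2, u1 ++ s1 = u2 ++ s2.
Proof.
move=> wf; elim: w q t1 t2 s1 s2 => [|a w IH] q t1 t2 s1 s2 qN w1 w2.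
  by move/acc_nil; lia.
case: (ltnP 2 q) => [q3|q2]; last first.
  have -> : q = 2 by lia.
  move/acc_cons; rewrite (wtape_scanned w1) (wtape_scanned w2) => /(_ ltac:(lia)) /=.
  move/acc_compare_eq => h; exists [::], [::].
  by apply: h (wtape_turn None w1) (wtape_turn None w2); lia.
have qN' : 2 < q <= N by lia.
move/(acc_write _ _ _ qN' w1 w2); have [_ /(_ q)] := wf.
case: (R q) => [//|q' o|f] /(_ ltac:(lia)) le; last first.
  move/(IH _ _ _ _ _ (le a) (wtape_write _ w1) (wtape_write _ w2)) => [u1 [u2 e]].
  by exists (u1 ++ [:: a]), (u2 ++ oseq (f a).2); rewrite -!catA.
case: a => //; move/(IH _ _ _ _ _ le (wtape_write _ w1) (wtape_write _ w2)) => [u1 [u2 e]].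
by exists u1, (u2 ++ oseq o); rewrite -catA.
Qed.

(** With right guesses, the second tape always holds the word of the first one followed by the
    present queue. Once the queue is empty, the tapes agree. *)
Lemma queue_acc R N c d t1 t2 s : wf_rules R N -> 2 <= c.1 <= N ->
  star (qstep R) c d -> d = (2, [::]) -> wtape t1 s -> wtape t2 (rev c.2 ++ s) ->
  exists w, forall y, acc R N c.1 t1 t2 (w ++ y).
Proof.
move=> wf + st; elim: st t1 t2 s => {c d} [x|[q v] c d e _ IH] t1 t2 s /=.
  move=> + xE; rewrite xE /= => N2 w1 w2.
  (* One letter for the turn, [size s] for the comparison, and one for the two blanks. *)
  exists (nseq (size s).+2 true) => y /=.
  apply/acc_cons; rewrite // (wtape_scanned w1) (wtape_scanned w2) /=.
  apply: acc_compare (wtape_turn None w1) (wtape_turn None w2) _; first lia.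
  by rewrite /= size_cat size_nseq; lia.
move=> qN dE w1 w2.
have q3 : 2 < q.
  by rewrite ltnNge; apply/negP => le; move: e; rewrite /= wf.1 //; lia.
have qN' : 2 < q <= N by lia.
have wr a y := acc_write R a y qN' w1 w2.
move: e; rewrite /=; have [_ /(_ q)] := wf; move: wr.
case: (R q) => [//|q' o|f] wr /(_ ltac:(lia)) le.
  case=> cE; rewrite -cE /= in IH.
  have [|w wE] := IH _ (act (write o) t2) s le dE (wtape_write None w1).
    by have := wtape_write o w2; rewrite rev_cat catA; case: (o).
  by exists (true :: w) => y; apply/wr.
case: v w2 wr => // a v w2 wr [cE]; rewrite -cE /= in IH.
have [|w wE] := IH _ (act (write (f a).2) t2) _ (le a) dE (wtape_write (Some a) w1).
  have := wtape_write (f a).2 w2; rewrite rev_cat rev_cons cat_rcons catA.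
  by case: (f a).2.
by exists (a :: w) => y; apply/wr.
Qed.

Lemma cat_suffix (T : eqType) (u v s : seq T) x y :
  u ++ x :: s = v ++ y :: s -> x = y.
Proof.
move=> e; have sz : size u = size v.
  by move/(congr1 size): e; rewrite !size_cat /=; lia.
by move/eqP: e; rewrite eqseq_cat // => /andP[_ /eqP[]].
Qed.

(** Right guesses follow the queue machine into a state without a rule; a wrong guess leaves a
    difference between the tapes that no later step erases. *)
Lemma queue_stuck_acc R N c d t1 t2 s w : wf_rules R N -> 2 <= c.1 <= N ->
  star (qstep R) c d -> 2 < d.1 -> R d.1 = Stop ->
  wtape t1 s -> wtape t2 (rev c.2 ++ s) -> ~ acc R N c.1 t1 t2 w.
Proof.
move=> wf + st d3 dS; elim: st t1 t2 s w d3 dS => {c d} [x|[q v] c d e _ IH] t1 t2 s [|a w].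
- by move=> x2 xS xN _ _ /acc_nil; lia.
- move=> x2 xS xN w1 w2; have xN' : 2 < x.1 <= N by lia.
  by move/(acc_write _ _ _ xN' w1 w2); rewrite xS.
- by move=> _ _ /= qN _ _ /acc_nil; lia.
move=> d2 dS /= qN w1 w2.
have q3 : 2 < q.
  by rewrite ltnNge; apply/negP => le; move: e; rewrite /= wf.1 //; lia.
have qN' : 2 < q <= N by lia.
move/(acc_write _ _ _ qN' w1 w2).
move: e; rewrite /=; have [_ /(_ q)] := wf.
case: (R q) => [//|q' o|f] /(_ ltac:(lia)) le.
  case=> cE; rewrite -cE /= in IH; case: a => //.
  apply: IH d2 dS le (wtape_write None w1) _.
  by have := wtape_write o w2; rewrite rev_cat catA; case: (o).
case: v w2 => // b v w2 [cE]; rewrite -cE /= in IH.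
have w1' := wtape_write (Some a) w1; have w2' := wtape_write (f a).2 w2.
(* Next to the common word [s], the first tape now has the guess [a] and the second one the true
   front letter [b]. A common extension forces them to be equal. *)
move=> h; have [u1 [u2]] := acc_writing_eq wf (le a) w1' w2' h.
rewrite rev_cons cat_rcons /= catA [in RHS]catA => /cat_suffix ab.
subst b.
apply: IH d2 dS (le a) w1' _ h.
by move: w2'; rewrite rev_cat rev_cons cat_rcons catA; case: (f a).2.
Qed.

(** * The reversal bound *)

Lemma reversals_right_left i j ds :
  [seq d <- ds | d != MoveStay] = nseq i MoveRight ++ nseq j MoveLeft ->
  reversals ds <= 1.
Proof.
rewrite /reversals => ->.
have const (d : move) n : count id (pairmap (fun d1 d2 => d1 != d2) d (nseq n d)) = 0.
  by elim: n => //= n ->; rewrite eqxx.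
case: i => [|i] /=; first by case: j => //= j; rewrite const.
elim: i => [|i IH] /=; last exact: IH.
by case: j => //= j; rewrite const.
Qed.

(** This concerns the moves made from state [q] on. The last two clauses let the shape survive a
    step put in front: after the simulation no head goes right, and in the sink none moves. *)
Definition one_turn (q : nat) (ds : seq move) : Prop :=
  exists i j, [/\ [seq d <- ds | d != MoveStay] = nseq i MoveRight ++ nseq j MoveLeft,
    q <= 2 -> i = 0 & q = 0 -> j = 0].

Lemma run_one_turn R N w c ds1 ds2 c' : @run (qmachine R N) c w = Some (ds1, ds2, c') ->
  wf_rules R N -> one_turn (cstate c : nat) ds1 /\ one_turn (cstate c : nat) ds2.
Proof.
move=> + wf; elim: w c ds1 ds2 => [|a w IH] [q t1 t2] ds1 ds2.
  by case=> <- <- _; split; exists 0, 0.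
rewrite /=; case actE: action => [[[q' b1] b2]|] //=.
case runE: run => [[[e1 e2] c1]|] // [<- <- cE].
rewrite cE in runE; have := IH _ _ _ runE; rewrite /=.
have small n : n <= 2 -> (q = n :> nat) -> N.+1 > n by move=> _ <-; apply: ltn_ord.
case qE: (nat_of_ord q) actE => [|[|[|n]]] /=.
- case: (scanned t1) (scanned t2) => [//|] [//|] [<- <- <-].
  by rewrite inordK.
- have N1 : 1 < N.+1 by apply: small qE.
  case: (scanned t1) (scanned t2) => [x|] [y|] //.
    case: eqP => // _ [<- <- <-]; rewrite inordK //.
    move=> -[[i [j [e1E /(_ isT) i0 _]]]] [i' [j' [e2E /(_ isT) i0' _]]].
    by split; [exists 0, j.+1 | exists 0, j'.+1]; split; rewrite //= ?e1E ?e2E ?i0 ?i0'.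
  case=> <- <- <-; rewrite inordK //.
  move=> -[[i [j [e1E /(_ isT) i0 /(_ erefl) j0]]]].
  move=> [i' [j' [e2E /(_ isT) i0' /(_ erefl) j0']]].
  by split; exists 0, 0; split; rewrite //= ?e1E ?e2E ?i0 ?i0' ?j0 ?j0'.
- have N2 : 2 < N.+1 by apply: small qE.
  case: (scanned t1) => // ; case: (scanned t2) => // -[<- <- <-].
  rewrite inordK; last lia.
  move=> -[[i [j [e1E /(_ isT) i0 _]]]] [i' [j' [e2E /(_ isT) i0' _]]].
  by split; [exists 0, j.+1 | exists 0, j'.+1]; split; rewrite //= ?e1E ?e2E ?i0 ?i0'.
move=> actE [[i [j [e1E _ j0]]] [i' [j' [e2E _ j0']]]].
have wrE o e k l : [seq d <- e | d != MoveStay] = nseq k MoveRight ++ nseq l MoveLeft ->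
    one_turn n.+3 ((write o).2 :: e).
  by case: o => [x|] /= h; [exists k.+1, l | exists k, l]; split=> //=; rewrite h.
move: actE; case: (scanned t1) => //; case: (scanned t2) => //.
case: (R _) => [//|q'' o|f].
  by case: (a) => // -[_ <- <-]; split; [apply: (wrE None) e1E | apply: wrE e2E].
by case=> _ <- <-; split; [apply: (wrE (Some a)) e1E | apply: wrE e2E].
Qed.

Lemma qmachine_reversal_bounded R N : wf_rules R N -> reversal_bounded 1 (qmachine R N).
Proof.
move=> wf w ds1 ds2 c e _.
have [[i [j [e1 _ _]]] [i' [j' [e2 _ _]]]] := run_one_turn e wf.
by split; [apply: reversals_right_left e1 | apply: reversals_right_left e2].
Qed.

Lemma qmachine_dense R N : wf_rules R N -> 2 <= N ->
  star (qstep R) (N, [::]) (2, [::]) -> dense (@language (qmachine R N)).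
Proof.
move=> wf N2 st y.
have [] := @queue_acc R N _ _
  (Tape 0%R (fun=> None)) (Tape 0%R (fun=> None)) [::] wf _ st erefl.
- by rewrite /= N2 leqnn.
- by split.
- by split.
move=> w /(_ (y ++ [::])); rewrite /acc /= (_ : inord N = ord_max).
  by exists w, [::].
by apply: val_inj; rewrite /= inordK.
Qed.

Lemma qmachine_not_dense R N d : wf_rules R N -> 2 <= N ->
  star (qstep R) (N, [::]) d -> 2 < d.1 -> R d.1 = Stop ->
  ~ dense (@language (qmachine R N)).
Proof.
(* The language is empty, so density already fails at the empty word. *)
move=> wf N2 st d3 dS /(_ [::]) [x [z h]].
have := @queue_stuck_acc R N _ _ (Tape 0%R (fun=> None)) (Tape 0%R (fun=> None)) [::]
  (x ++ [::] ++ z) wf _ st d3 dS.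
case.
- by rewrite /= N2 leqnn.
- by split.
- by split.
rewrite /acc /= (_ : inord N = ord_max) //.
by apply: val_inj; rewrite /= inordK.
Qed.

(** * Codes of machines *)

Import CodeSeq.

Lemma code_cons x s : code (x :: s) = 2 ^ x * (code s).*2.+1.
Proof. by []. Qed.

(** The number of binary digits of [code s]. *)
Definition code_length (s : seq nat) : nat := sumn s + size s.

(** In binary, the digits of [code t] stand above those of [code s]. *)
Lemma code_cat s t : code (s ++ t) = code s + 2 ^ code_length s * code t.
Proof.
rewrite /code_length; elim: s => [|x s IH]; first by rewrite /= mul1n.
rewrite cat_cons !code_cons IH [sumn _]/= [size (_ :: _)]/=.
have -> : x + sumn s + (size s).+1 = x + (1 + (sumn s + size s)) by lia.
rewrite [2 ^ (x + _)]expnD [2 ^ (1 + _)]expnD doubleD -addSn mulnDr; congr (_ + _).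
by rewrite -mul2n !mulnA.
Qed.

Lemma code_bounds x s : let b := sumn (x :: s) + size s in
  2 ^ b <= code (x :: s) < 2 ^ b.+1.
Proof.
elim: s x => [|y s IH] x.
  by rewrite /= !addn0 (muln1 (2 ^ x)) leqnn ltn_exp2l // ltnSn.
rewrite code_cons [sumn _]/= [size _]/=; have := IH y.
rewrite (_ : x + _ + _ = x + (1 + (sumn (y :: s) + size s))); last by rewrite /=; lia.
move: (sumn _ + _) (code _) => b c; rewrite /= -addnS !expnD !expnS expn0.
case/andP=> lo hi.
by rewrite leq_mul2l ltn_mul2l expn_gt0 /=; lia.
Qed.

(** This recovers the shift in [code_cat] from [code s] alone, so that the list [s] need not be
    decoded. *)
Lemma up_log_code s : up_log 2 (code s).+1 = code_length s.
Proof.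
case: s => [|x s]; first by rewrite up_log1.
by rewrite /code_length [size _]/= addnS; apply: up_log_eq => //; apply: code_bounds.
Qed.

Lemma mem_code x s : x \in s -> x < code s.
Proof.
elim: s => // y s IH; rewrite inE code_cons.
have := ltn_expl y (isT : 1 < 2); move: (2 ^ y) => a ya.
by case/orP => [/eqP->|/IH]; nia.
Qed.

Lemma enum_prod (T1 T2 : finType) :
  enum {: T1 * T2} = [seq (x1, x2) | x1 <- enum T1, x2 <- enum T2].
Proof. by rewrite [LHS]enumT [in LHS]unlock. Qed.

Lemma enum_option (T : finType) : enum {: option T} = None :: map some (enum T).
Proof. by rewrite !enumT [in LHS]unlock. Qed.

Lemma enum_bool : enum {: bool} = [:: true; false].
Proof. by rewrite enumT unlock. Qed.

Lemma enum_rankE (T : finType) (x : T) : enum_rank x = index x (enum T) :> nat.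
Proof.
by rewrite -{2}(nth_enum_rank x x) index_uniq ?enum_uniq // -cardE ltn_ord.
Qed.

Lemma pmap_flatten (T U : Type) (f : T -> option U) s :
  pmap f s = flatten [seq oseq (f x) | x <- s].
Proof. by elim: s => //= x s ->; case: (f x). Qed.

Lemma flatten_map_pairs (T1 T2 U : Type) (f : T1 * T2 -> seq U) s t :
  flatten [seq f p | p <- [seq (x, y) | x <- s, y <- t]] =
  flatten [seq flatten [seq f (x, y) | y <- t] | x <- s].
Proof.
by elim: s => //= x s IH; rewrite map_cat flatten_cat IH -map_comp.
Qed.

Definition row (R : nat -> rule nat) (q : nat) (a : bool) (g h : option bool) :
    option nat :=
  if action R q a g h is Some (q', (g', d1), (h', d2)) then
    Some (code [:: q; enum_rank a : nat; enum_rank g : nat; enum_rank h : nat;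
                   q'; enum_rank g' : nat; nat_of_move d1;
                   enum_rank h' : nat; nat_of_move d2])
  else None.

Definition rows (R : nat -> rule nat) (q : nat) : seq nat :=
  flatten [seq flatten [seq flatten [seq oseq (row R q a g h)
    | h <- enum {: option bool}] | g <- enum {: option bool}] | a <- enum {: bool}].

Lemma action_le R N q a g h q' b1 b2 : wf_rules R N -> 2 <= N -> q <= N ->
  action R q a g h = Some (q', b1, b2) -> q' <= N.
Proof.
case=> _ wf N2 qN; case: q qN => [|[|[|q]]] qN /=; case: g h => [x|] [y|] //.
- by case=> <-.
- by case: eqP => // _ [<- _ _]; lia.
- by case=> <-.
- by case=> <- _ _; lia.
have := wf _ qN; case: (R _) => [//|q'' o|f] le; last first.
  by case=> <- _ _; have := le a; lia.
by case: a => // -[<- _ _]; lia.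
Qed.

Lemma encode_qmachine R N : wf_rules R N -> 2 <= N ->
  encode (qmachine R N) =
  code [:: N.+1; 2; 3; N; 0; 1; code (flatten [seq rows R q | q <- iota 0 N.+1])].
Proof.
(* The entry 1 is the code of the list [[:: 0]] of final states, and 0 is the rank of the blank. *)
move=> wf N2; rewrite /encode; congr (code [:: _; _; _; _; _; _; code _]).
- exact: card_ord.
- exact: card_bool.
- by rewrite /= card_option card_bool.
- by rewrite /= enum_rank_ord.
- by rewrite enum_rankE enum_option.
- by rewrite /= enum_set1 /= enum_rank_ord.
rewrite pmap_flatten enum_prod flatten_map_pairs enum_prod flatten_map_pairs.
rewrite enum_prod flatten_map_pairs -val_enum_ord -map_comp.
congr flatten; apply: eq_map => q; rewrite /= /rows.
congr flatten; apply: eq_map => a; congr flatten; apply: eq_map => g.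
congr flatten; apply: eq_map => h; congr oseq.
rewrite /encode_instr /= /row; case e: action => [[[q' [g' d1]] [h' d2]]|] //=.
have q'N := action_le wf N2 (ltn_ord q) e.
by rewrite !enum_rank_ord /= inordK.
Qed.

Lemma rows_stop R q : 2 < q -> R q = Stop -> rows R q = [::].
Proof.
case: q => [|[|[|q]]] // _ e; rewrite /rows enum_option enum_bool /= /row /= e.
by [].
Qed.

Lemma rows_silent R q q' o : 2 < q -> R q = Silent q' o -> rows R q =
  [:: code [:: q; 0; 0; 0; q'; 0; 1; enum_rank (write o).1 : nat;
              nat_of_move (write o).2]].
Proof.
case: q => [|[|[|q]]] // _ e; rewrite /rows enum_option enum_bool /= /row /= e /=.
case ew: (write o) => [g d] /=.
by rewrite !enum_rankE enum_option enum_bool.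
Qed.

Lemma rows_gt R q : 2 < q -> R q <> Stop -> exists2 x, x \in rows R q & q < x.
Proof.
case: q => [|[|[|q]]] // _; rewrite /rows enum_option enum_bool /= /row /=.
have lt m : q.+3 < 2 ^ q.+3 * m.+1.
  by apply: leq_trans (ltn_expl _ (isT : 1 < 2)) _; rewrite leq_pmulr.
case: (R _) => // [q' o|f] _.
  by case: (write o) => g d /=; eexists; [exact: mem_head | exact: lt].
by case: (write _) => g d /=; eexists; [exact: mem_head | exact: lt].
Qed.

(** On [true] and two blanks, state [q] goes to [q.-1], leaves the first tape alone, writes [true]
    on the second one and moves right there. *)
Definition chain_row (q : nat) : nat := code [:: q; 0; 0; 0; q.-1; 0; 1; 1; 2].

(** The code of the rows of the last [k] states up to [m], in the shape of a primitive recursion on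
    [k]. *)
Fixpoint chain_code (k m : nat) : nat :=
  if k is k'.+1 then 2 ^ chain_row (m - k') * (chain_code k' m).*2.+1 else 0.

Lemma chain_codeE k m : k <= m ->
  chain_code k m = code [seq chain_row q | q <- iota (m - k).+1 k].
Proof.
elim: k => // k IH km; rewrite [LHS]/= (IH (ltnW km)).
by rewrite -[iota _ k.+1]/(_ :: iota _ k) map_cons code_cons subnSK.
Qed.

(** The instruction list is a fixed part with code [A], then the instruction of state [A], which
    leads to state 3, then the chain of states up to [A.*2]. The last entry joins the codes of these
    pieces as in [code_cat]. *)
Definition self_code (A : nat) : nat :=
  code [:: A.*2.+1; 2; 3; A.*2; 0; 1;
    A + 2 ^ up_log 2 A.+1 *
      (2 ^ code [:: A; 0; 0; 0; 3; 0; 1; 0; 1] * (chain_code A A.*2).*2.+1)].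

Lemma encode_chain R c A : A = code (flatten [seq rows R q | q <- iota 0 c]) ->
  2 < c <= A -> (forall q, c <= q -> R q = Stop) -> wf_rules (chain_rule R A) A.*2 ->
  encode (qmachine (chain_rule R A) A.*2) = self_code A.
Proof.
move=> AE /andP[c2 cA] stop wf; rewrite encode_qmachine //; last lia.
congr (code [:: _; _; _; _; _; _; _]).
(* The states below [c] form the fixed part, those from [c] to [A.-1] have no instruction, [A] ends
   the chain, and the [A] states above it enqueue. *)
have -> : A.*2.+1 = c + ((A - c) + (1 + A)) by lia.
rewrite !iotaD !map_cat !flatten_cat add0n subnKC //.
(* The rules below [A] do not depend on [A], so taking [A] to be their code is not circular. *)
have below q : q < A -> rows (chain_rule R A) q = rows R q.
  by rewrite /rows /row /action /chain_rule; case: q => [|[|[|q]]] // ->.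
have -> : [seq rows (chain_rule R A) q | q <- iota 0 c] =
    [seq rows R q | q <- iota 0 c].
  apply/eq_in_map => q; rewrite mem_iota => /andP[_ qc]; apply: below.
  exact: leq_trans cA.
rewrite code_cat -AE {2}AE -up_log_code -AE; congr (_ + _ * _).
have -> : flatten [seq rows (chain_rule R A) q | q <- iota c (A - c)] = [::].
  have : forall q, q \in iota c (A - c) -> rows (chain_rule R A) q = [::].
    move=> q; rewrite mem_iota => qc; rewrite below ?rows_stop ?stop //; lia.
  by elim: iota => //= q s IH e; rewrite e ?mem_head // IH // => x xs;
    rewrite e ?inE ?xs ?orbT.
rewrite /= (@rows_silent _ _ 3 None) /=; last 2 first.
- exact: leq_trans cA.
- by rewrite /chain_rule ltnn eqxx.
rewrite enum_rankE enum_option /=; congr (_ * _.*2.+1).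
rewrite chain_codeE; last lia.
rewrite (_ : A.*2 - A = A) ?addn1; last lia.
have : forall q, q \in iota A.+1 A -> rows (chain_rule R A) q = [:: chain_row q].
  move=> q; rewrite mem_iota => qA; rewrite (@rows_silent _ _ q.-1 (Some true)).
  - by rewrite /= enum_rankE enum_option enum_bool.
  - lia.
  - by rewrite /chain_rule ltnNge ltnW ?gtn_eqF //; lia.
elim: (iota _ _) => //= q s IH e; rewrite e ?mem_head //= IH // => x xs.
by rewrite e // inE xs orbT.
Qed.

(** * Recursiveness of [self_code] *)

Definition recursive (n : nat) (F : seq nat -> nat) : Prop :=
  exists f, forall v, size v = n -> eval f v (F v).

Definition recursive1 (F : nat -> nat) := recursive 1 (fun v => F (nth 0 v 0)).
Definition recursive2 (F : nat -> nat -> nat) :=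
  recursive 2 (fun v => F (nth 0 v 0) (nth 0 v 1)).

Lemma eq_recursive n F F' : (forall v, size v = n -> F v = F' v) ->
  recursive n F -> recursive n F'.
Proof. by move=> e [f h]; exists f => v vn; rewrite -e //; apply: h. Qed.

Lemma rec_proj n i : i < n -> recursive n (fun v => nth 0 v i).
Proof. by move=> lt; exists (RProj i) => v vn; constructor; rewrite vn. Qed.

Lemma rec_comp1 n G F : recursive1 G -> recursive n F -> recursive n (fun v => G (F v)).
Proof.
move=> [g hg] [f hf]; exists (RComp g [:: f]) => v vn.
apply: EvalComp (hg [:: F v] erefl).
by apply: EvalsCons (EvalsNil _); apply: hf.
Qed.

Lemma rec_comp2 n G F1 F2 : recursive2 G -> recursive n F1 -> recursive n F2 ->
  recursive n (fun v => G (F1 v) (F2 v)).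
Proof.
move=> [g hg] [f1 h1] [f2 h2]; exists (RComp g [:: f1; f2]) => v vn.
apply: EvalComp (hg [:: F1 v; F2 v] erefl).
by apply: EvalsCons (EvalsCons _ (EvalsNil _)); [apply: h1 | apply: h2].
Qed.

Lemma rec_succ n F : recursive n F -> recursive n (fun v => (F v).+1).
Proof.
apply: rec_comp1; exists RSucc; case=> // x v _; exact: EvalSucc.
Qed.

Lemma rec_const n c : recursive n (fun=> c).
Proof.
elim: c => [|c IH]; last exact: rec_succ IH.
by exists RZero => v _; apply: EvalZero.
Qed.

Lemma rec_prec2 G H (K : nat -> nat -> nat) : recursive1 G -> recursive 3 H ->
  (forall m, K 0 m = G m) -> (forall k m, K k.+1 m = H [:: k; K k m; m]) ->
  recursive2 K.
Proof.
move=> [g hg] [h hh] K0 KS; exists (RPrec g h) => -[|k [|m [|]]] //= _.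
elim: k => [|k IH]; first by apply: EvalPrec0; rewrite K0; apply: hg.
by apply: EvalPrecS IH _; rewrite KS; apply: hh.
Qed.

Lemma rec_add : recursive2 addn.
Proof.
apply: (@rec_prec2 id (fun v => (nth 0 v 1).+1)) => //; first exact: rec_proj.
by apply: rec_succ; apply: rec_proj.
Qed.

Lemma rec_mul : recursive2 muln.
Proof.
apply: (@rec_prec2 (fun=> 0) (fun v => nth 0 v 2 + nth 0 v 1)) => //.
  exact: rec_const.
by apply: rec_comp2 rec_add _ _; apply: rec_proj.
Qed.

Lemma rec_pow2 : recursive1 (expn 2).
Proof.
suff h : recursive2 (fun k _ => 2 ^ k).
  by apply: (rec_comp2 h (F2 := fun v => nth 0 v 0)); apply: rec_proj.
apply: (@rec_prec2 (fun=> 1) (fun v => 2 * nth 0 v 1)) => [||//|k m].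
- exact: rec_const.
- by apply: rec_comp2 rec_mul _ _; [apply: rec_const | apply: rec_proj].
- by rewrite expnS.
Qed.

Lemma rec_pred : recursive1 predn.
Proof.
suff h : recursive2 (fun k _ => k.-1).
  by apply: (rec_comp2 h (F2 := fun v => nth 0 v 0)); apply: rec_proj.
apply: (@rec_prec2 (fun=> 0) (fun v => nth 0 v 0)) => //; first exact: rec_const.
exact: rec_proj.
Qed.

Lemma rec_sub n F1 F2 : recursive n F1 -> recursive n F2 ->
  recursive n (fun v => F1 v - F2 v).
Proof.
move=> r1 r2; suff h : recursive2 (fun k m => m - k) by apply: (rec_comp2 h r2 r1).
apply: (@rec_prec2 id (fun v => (nth 0 v 1).-1)) => [||m|k m].
- exact: rec_proj.
- by apply: rec_comp1 rec_pred _; apply: rec_proj.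
- exact: subn0.
- exact: subnS.
Qed.

Lemma rec_double n F : recursive n F -> recursive n (fun v => (F v).*2).
Proof.
move=> r; apply: eq_recursive (rec_comp2 rec_add r r) => v _.
exact: addnn.
Qed.

Lemma rec_code_cons n F T : recursive n F -> recursive n T ->
  recursive n (fun v => 2 ^ F v * (T v).*2.+1).
Proof.
move=> rF rT; apply: rec_comp2 rec_mul _ _; first exact: rec_comp1 rec_pow2 _.
by apply: rec_succ; apply: rec_double.
Qed.

Lemma rec_up_log n F : recursive n F -> recursive n (fun v => up_log 2 (F v).+1).
Proof.
apply: (@rec_comp1 _ (fun m => up_log 2 m.+1)).
have [f hf] : recursive2 (fun k m => m.+1 - 2 ^ k).
  apply: rec_sub; first by apply: rec_succ; apply: rec_proj.
  by apply: rec_comp1 rec_pow2 _; apply: rec_proj.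
exists (RMin f) => -[|m [|]] //= _.
(* The search finds the least [k] with [m.+1 - 2 ^ k = 0]. All earlier values are positive, with
   predecessors [m - 2 ^ k]. *)
apply: (EvalMin (h := fun k => m - 2 ^ k)) => [k lt|].
  have -> : (m - 2 ^ k).+1 = m.+1 - 2 ^ k.
    rewrite subSn // leqNgt; apply: contraL lt => lt.
    by rewrite -leqNgt up_log_min.
  exact: hf [:: k; m] erefl.
have := hf [:: up_log 2 m.+1; m] erefl; rewrite /= (_ : _ - _ = 0) //.
by apply/eqP; rewrite subn_eq0 up_logP.
Qed.

Lemma rec_code n (Fs : seq (seq nat -> nat)) : all_prop (recursive n) Fs ->
  recursive n (fun v => code [seq F v | F <- Fs]).
Proof.
elim: Fs => [_|F Fs IH [rF /IH rFs]]; first exact: rec_const.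
exact: rec_code_cons.
Qed.

Lemma rec_chain_row n F : recursive n F -> recursive n (fun v => chain_row (F v)).
Proof.
move=> r; apply: (rec_code (Fs := [:: F; fun=> 0; fun=> 0; fun=> 0;
  fun v => (F v).-1; fun=> 0; fun=> 1; fun=> 1; fun=> 2])).
do !split=> //; try exact: rec_const.
exact: rec_comp1 rec_pred r.
Qed.

Lemma rec_chain_code : recursive2 chain_code.
Proof.
apply: (@rec_prec2 (fun=> 0)
  (fun v => 2 ^ chain_row (nth 0 v 2 - nth 0 v 0) * (nth 0 v 1).*2.+1)) => //.
  exact: rec_const.
apply: rec_code_cons; last exact: rec_proj.
by apply: rec_chain_row; apply: rec_sub; apply: rec_proj.
Qed.

Lemma rec_self_code : recursive1 self_code.
Proof.
have A : recursive 1 (fun v => nth 0 v 0) by apply: rec_proj.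
have A2 := rec_double A.
apply: (rec_code (Fs := [:: fun v => (nth 0 v 0).*2.+1; fun=> 2; fun=> 3;
  fun v => (nth 0 v 0).*2; fun=> 0; fun=> 1;
  fun v => nth 0 v 0 + 2 ^ up_log 2 (nth 0 v 0).+1 *
    (2 ^ code [:: nth 0 v 0; 0; 0; 0; 3; 0; 1; 0; 1] *
       (chain_code (nth 0 v 0) (nth 0 v 0).*2).*2.+1)])).
do !split=> //; try exact: rec_const; first exact: rec_succ.
apply: (rec_comp2 rec_add A); apply: rec_comp2 rec_mul _ _.
  by apply: rec_comp1 rec_pow2 _; apply: rec_up_log.
apply: rec_code_cons; last exact: (rec_comp2 rec_chain_code A A2).
apply: (rec_code (Fs := [:: fun v => nth 0 v 0; fun=> 0; fun=> 0; fun=> 0;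
  fun=> 3; fun=> 0; fun=> 1; fun=> 0; fun=> 1])).
by do !split=> //; exact: rec_const.
Qed.

(** * The self-referential machine *)

Definition all_states (P k : nat) : seq (nat * nat * bool) :=
  [seq (x, b) | x <- [seq (pc, j) | pc <- iota 0 P, j <- iota 0 k.+1],
                b <- [:: false; true]].

Lemma mem_all_states P k pc j b :
  ((pc, j, b) \in all_states P k) = (pc < P) && (j <= k).
Proof.
apply/idP/idP => [|/andP[pP jk]].
  case/allpairsPdep => x [b' [xin _ [xE _]]]; move: xin; rewrite -xE.
  by case/allpairsPdep => p [i [+ + [-> ->]]]; rewrite !mem_iota /= !add0n ltnS => -> ->.
apply: (allpairs_f pair); last by case: (b).
by apply: (allpairs_f pair); rewrite mem_iota.
Qed.

Lemma fetch_size prog pc : size prog <= pc -> fetch prog pc = None.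
Proof. by move=> le; rewrite /fetch nth_default ?size_map. Qed.

Lemma fetch_lt prog pc : pc < size prog -> fetch prog pc <> None.
Proof. by move=> lt; rewrite /fetch (nth_map CStart). Qed.

Lemma qrule_out k prog y : y \notin all_states (size prog) k ->
  qrule k prog (Some y) = Stop.
Proof.
case: y => [[pc j] b]; rewrite mem_all_states /= => out.
case: leqP => // jk; rewrite jk andbT -leqNgt in out.
by rewrite fetch_size.
Qed.

Lemma qrule_in k prog y : y \in all_states (size prog) k ->
  qrule k prog (Some y) <> Stop.
Proof.
case: y => [[pc j] b]; rewrite mem_all_states /= => /andP[pcP ->].
case: fetch (fetch_lt pcP) => // -[||r|r l|l] _ /=; rewrite /copy_rule;
  by repeat case: ifP.
Qed.

(** The initial value 1 keeps register 0, which holds the input, inside the store. *)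
Definition reg_bound (prog : seq instr) : nat :=
  foldr (fun i k => match i with CInc r | CDec r _ => maxn r.+1 k | _ => k end) 1 prog.

Lemma reg_bound_gt0 prog : 0 < reg_bound prog.
Proof. by elim: prog => //= -[||r|r l|l] prog; lia. Qed.

Lemma regs_below_bound prog : regs_below (reg_bound prog) prog.
Proof.
have mono k k' : k <= k' -> regs_below k prog -> regs_below k' prog.
  by move=> le; apply: sub_all => -[||r|r l|l] //= h; apply: leq_trans h le.
rewrite /regs_below; elim: prog {mono} => //= i prog IH; apply/andP; split.
  by case: i => //= *; apply: leq_maxl.
apply: sub_all IH => -[||r|r l|l] //= h; case: i => //= *; lia.
Qed.

(* The program halts on value 0 and crashes on value 1. *)
Definition zero_test (g : recfun) : seq instr :=
  [:: CStart; CHalt] ++ flat (compile g [:: 0] 1 2) 2 ++ [:: CDec 1 1].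

Lemma zero_test_run g A y : eval g [:: A] y ->
  let prog := zero_test g in
  exists2 s, star (cstep prog) (2, upd (fun=> 0) 0 A) ((size prog).-1, s) & s 1 = y.
Proof.
move=> ev prog.
have [s ex s1] : wp (compile g [:: 0] 1 2) (upd (fun=> 0) 0 A) (fun s => s 1 = y).
  by apply: (compile_correct ev).
exists s => //; have := @exec_flat prog _ _ _ ex 2.
rewrite (_ : (size prog).-1 = 2 + size (flat (compile g [:: 0] 1 2) 2)); last first.
  by rewrite /prog /zero_test !size_cat /= addn1 !addSn.
by apply; apply: (code_at_mid [:: CStart; CHalt]).
Qed.

Lemma zero_test_last g : fetch (zero_test g) (size (zero_test g)).-1 = Some (CDec 1 1).
Proof.
rewrite /fetch /zero_test catA size_cat addn1 map_cat nth_cat.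
by rewrite size_map ltnn subnn.
Qed.

(** The rules [R] depend on [g] alone, and hence so does their code [A]. The chain hands [A] to the
    program for [g], and the code of the whole machine is a function of [A]. *)
Lemma self_referential_machine (g : recfun) : exists A (M : machine),
  [/\ reversal_bounded 1 M, encode M = self_code A,
      eval g [:: A] 0 -> dense (@language M) &
      eval g [:: A] 1 -> ~ dense (@language M)].
Proof.
set prog := zero_test g; set k := reg_bound prog.
set sts := all_states (size prog) k.
pose R := ranked_rule (qrule k prog) sts.
(* The listed states have ranks up to [(size sts).+2]; the rank [(size sts).+3] is shared by all
   unlisted ones. *)
pose c := (size sts).+4.
pose A := CodeSeq.code (flatten [seq rows R q | q <- iota 0 c]).
have sts0 : 0 < size sts by [].
(* The last listed state has rank [(size sts).+2]. It has an instruction with a larger code [x], and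
   [A] is larger still. *)
have cA : c <= A.
  have [||x xin xgt] := @rows_gt R (size sts).+2; first lia.
    have lt : (size sts).-1 < size sts by rewrite prednK.
    rewrite /R -(prednK sts0) /ranked_rule prednK // lt.
    by have /qrule_in := mem_nth (0, 0, false) lt; case: (qrule _ _ _).
  have : x \in flatten [seq rows R q | q <- iota 0 c].
    by apply/flatten_mapP; exists (size sts).+2; rewrite // mem_iota /c add0n ltnS leqnSn.
  by move/mem_code; rewrite -/A /c; lia.
have stop q : c <= q -> R q = Stop.
  case: q => [|[|[|q]]] //; rewrite /c !ltnS /R /ranked_rule => le.
  by rewrite ltnNge ltnW.
pose R' := chain_rule R A.
have R'R q : q < A -> R' q = R q by rewrite /R' /chain_rule => ->.
have wf : wf_rules R' A.*2.
  split=> [q q3|q qA]; first by rewrite R'R; [case: q q3 => [|[|[|]]] | lia].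
  have rank2 x : 2 <= rank sts x <= A.*2.
    by have := leq_trans (rank_ltn sts x) cA; case: x => [y|] /=; lia.
  rewrite /R' /chain_rule; case: ltnP => [_|Aq].
    rewrite /R; case: q {qA} => [|[|[|q]]] //; rewrite /ranked_rule; case: ifP => // _.
    by case: (qrule _ _ _) => [|x o|f] //; [apply: rank2 | move=> a; apply: rank2].
  by case: eqP => _; lia.
have A2 : 2 <= A.*2 by lia.
have sim c1 c2 : star (qstep (qrule k prog)) c1 c2 ->
    star (qstep R') (rank sts c1.1, c1.2) (rank sts c2.1, c2.2).
  apply: star_ranked => [y|//|q qc]; first exact: qrule_out.
  by rewrite R'R //; apply: leq_trans qc cA.
have run y : eval g [:: A] y -> exists2 s, s 1 = y &
    star (qstep R') (A.*2, [::])
      (rank sts (Some ((size prog).-1, 0, false)), blocks s 0 k).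
  move=> ev; have [s st s1] := zero_test_run ev; exists s => //.
  have := chain_queue R A A [::]; rewrite addnn => h; apply: star_trans h _.
  (* The triple [(0, 0, false)] comes first in [sts], so its rank is the state 3 in which the chain
     ends. *)
  apply: (sim (Some (0, 0, false), nseq A true) (Some _, blocks s 0 k)).
  apply: star_trans (start_queue _ _ _) _; first by [].
    exact: reg_bound_gt0.
  exact: cstar_queue (regs_below_bound _) st.
exists A, (qmachine R' A.*2); split.
- exact: qmachine_reversal_bounded.
- exact: (@encode_chain R c A).
- move=> /run[s s1 st]; apply: qmachine_dense => //.
  apply: star_trans st _.
  apply: (sim (Some _, _) (None, [::])).
  (* On value 0 the final test jumps to [CHalt] at address 1; on value 1 it falls through to the
     address [size prog], which has no rule. *)
  have e : cstep prog ((size prog).-1, s) = Some (1, s).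
    by rewrite /cstep zero_test_last s1.
  apply: star_trans (cstep_queue (regs_below_bound _) e) _.
  exact: halt_queue.
- move=> /run[s s1 st].
  have e : cstep prog ((size prog).-1, s) = Some (size prog, upd s 1 0).
    by rewrite /cstep zero_test_last s1.
  have st' := cstep_queue (regs_below_bound _) e.
  apply: qmachine_not_dense wf A2 (star_trans st (sim _ _ st')) _ _ => //.
  rewrite R'R; last by apply: leq_trans (rank_ltn _ _) cA.
  rewrite /R ranked_ruleE // => [|y]; last exact: qrule_out.
  by rewrite /= fetch_size.
Qed.

(* [f] is only constrained on codes of 1-reversal-bounded machines. *)
Theorem corollary10 :
  ~ exists f : recfun,
      forall M : machine, reversal_bounded 1 M ->
        (dense (@language M) -> eval f [:: encode M] 1) /\
        (~ dense (@language M) -> eval f [:: encode M] 0).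
Proof.
case=> f decides; have [r rE] := rec_self_code.
(* At [A], this composition returns the verdict of [f] on [M], whose code is [self_code A]. *)
have [A [M [bounded code0 dense0 dense1]]] := self_referential_machine (RComp f [:: r]).
have [yes no] := decides M bounded.
have comp y : eval f [:: encode M] y -> eval (RComp f [:: r]) [:: A] y.
  by rewrite code0; apply: EvalComp; apply: EvalsCons (rE [:: A] erefl) (EvalsNil _).
(* No case distinction on density is made: it is refuted first, and then the verdict 0 makes the
   language dense. *)
have not_dense : ~ dense (@language M) by move=> d; apply: dense1 (comp _ (yes d)) d.
exact/not_dense/dense0/comp/no.
Qed.
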